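(* Let $K$ be a division ring, let $\Gamma$ be a totally ordered abelian group, let $\nu:K^\times\to\Gamma$ be a surjective additive valuation, and let $\sigma$ be an involution of $K$ such that $\nu(2)=0$, $\nu\circ\sigma=\nu$, and for every $\gamma\in\Gamma$ there is $a\in K$ with $\nu(a)=\gamma$ and $a=a^\sigma$. Let $S=\{a\in K:\nu(a)\ge 0\}$. Then two unimodular $1$-hermitian forms over $(S,\sigma)$ are isometric over $K$ (i.e. over $(K,\sigma)$) if and only if they are isometric over $S$.
   Context: An involution $\sigma$ on a ring is an anti-automorphism with $\sigma\circ\sigma=\mathrm{id}$ (the identity is allowed when the ring is commutative); write $a^\sigma$ for $\sigma(a)$. An additive valuation $\nu:K^\times\to\Gamma$ on a division ring, extended by $\nu(0)=\infty$, satisfies $\nu(ab)=\nu(a)+\nu(b)$ and $\nu(a+b)\ge\min\{\nu(a),\nu(b)\}$. Since $\nu\circ\sigma=\nu$, $\sigma$ restricts to an involution of $S$, also denoted $\sigma$. A $1$-hermitian space over a ring with involution $(S,\sigma)$ is a pair $(M,h)$ where $M$ is a projective left $S$-module and $h:M\times M\to S$ is a biadditive map with $h(ax,by)=a\,h(x,y)\,b^\sigma$ and $h(x,y)=h(y,x)^\sigma$ for all $x,y\in M$ and $a,b\in S$; then $h$ is called a $1$-hermitian form. The form $h$ is unimodular if the map $\tilde h:M\to\mathrm{Hom}_S(M,S)$ given by $\tilde h(x)=[y\mapsto h(y,x)]$ is an isomorphism (it is additive and $\sigma$-semilinear, so this means it is bijective). Two hermitian spaces $(M,h)$ and $(M',h')$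 over $(S,\sigma)$ are isometric (over $S$) if there is an isomorphism of left $S$-modules $u:M\to M'$ with $h'(ux,uy)=h(x,y)$ for all $x,y\in M$. If $(K,\tau)$ is a ring with involution containing $(S,\sigma)$, then $(M,h)$ gives rise to a hermitian space $(M_K,h_K)$ over $(K,\tau)$ with $M_K=K\otimes_S M$ and $h_K(a\otimes x,b\otimes y)=a\,h(x,y)\,b^\tau$ for $x,y\in M$, $a,b\in K$. The spaces $(M,h)$ and $(M',h')$ are isometric over $(K,\tau)$ if $(M_K,h_K)$ and $(M'_K,h'_K)$ are isometric. *)

(* Defs.v *)
From HB Require Import structures.
From mathcomp Require Import all_boot all_order all_algebra.
From mathcomp Require Import boolp.

Set Implicit Arguments.
Unset Strict Implicit.
Unset Printing Implicit Defensive.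

Import Order.TTheory GRing.Theory.
Local Open Scope ring_scope.
Local Open Scope quotient_scope.

(* Totality is a field of the mixin, rather than an inheritance from
   [Order.Total], because the library declares no join of lattices with
   [Zmodule] below [Num.RealDomain]. *)
HB.mixin Record isOrderedZmodule G of Num.POrderedZmodule G := {
  oz_le_total : forall x y : G, (x <= y) || (y <= x);
  oz_leD2r : forall x y z : G, x <= y -> x + z <= y + z
}.

#[short(type="orderedZmodType")]
HB.structure Definition OrderedZmodule :=
  { G of isOrderedZmodule G & Num.POrderedZmodule G }.

Section Extended.
Variable G : orderedZmodType.
Implicit Types x y : option G.

(* [None] stands for infinity. *)
Definition vadd x y : option G :=
  if x is Some a then if y is Some b then Some (a + b) else None else None.

Definition vle x y : bool :=
  if y is Some b then if x is Some a then a <= b else false else true.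

Definition vmin x y : option G := if vle x y then x else y.

End Extended.

Record valuation (K : nzRingType) (G : orderedZmodType) := Valuation {
  val_fun :> K -> option G;
  val_infty : forall a, val_fun a = None <-> a = 0;
  valM : forall a b, val_fun (a * b) = vadd (val_fun a) (val_fun b);
  valD : forall a b, vle (vmin (val_fun a) (val_fun b)) (val_fun (a + b))
}.

Section ValuationRing.
Variables (K : nzRingType) (G : orderedZmodType) (v : valuation K G).

Definition val_ring_pred : {pred K} := fun a => vle (Some 0) (v a).

Lemma val1 : v 1 = Some 0.
Proof.
have := valM v 1 1; rewrite mulr1.
case E: (v 1) => [g|] /=; last by move/val_infty/eqP: E; rewrite oner_eq0.
by move=> [/esym/eqP]; rewrite -subr_eq0 addrK => /eqP->.
Qed.

Lemma valN1 : v (-1) = Some 0.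
Proof.
have := valM v (-1) (-1); rewrite mulrNN mulr1 val1.
case: (v (-1)) => [g|] //= [] g2; congr Some.
by case/orP: (oz_le_total 0 g) => g0; have := oz_leD2r _ _ g g0;
  rewrite -g2 add0r => g0'; apply/eqP; rewrite eq_le g0 g0'.
Qed.

Lemma val_ring_closed : subring_closed val_ring_pred.
Proof.
have M a b : a \in val_ring_pred -> b \in val_ring_pred ->
    a * b \in val_ring_pred.
  rewrite !unfold_in valM /vle; case: (v a) => [x|] //; case: (v b) => [y|] //=.
  by move=> x0 y0; apply: (le_trans y0); have := oz_leD2r _ _ y x0; rewrite add0r.
have N1 : -1 \in val_ring_pred by rewrite unfold_in valN1 /=.
split=> // [|a b aS bS]; first by rewrite unfold_in val1 /=.
have {}bS : - b \in val_ring_pred by rewrite -mulN1r; apply: M.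
move: aS bS (valD v a (- b)); rewrite !unfold_in /vmin.
case: (v a) => [x|]; case: (v (- b)) => [y|]; case: (v (a - b)) => [z|] //=.
- by case: ifP => _ x0 y0; apply: le_trans.
- by move=> x0 _; apply: le_trans.
- by move=> _ y0; apply: le_trans.
Qed.

HB.instance Definition _ :=
  GRing.isSubringClosed.Build K val_ring_pred val_ring_closed.

Definition val_ring := {a : K | a \in val_ring_pred}.

HB.instance Definition _ := SubType.on val_ring.
HB.instance Definition _ := Choice.on val_ring.
HB.instance Definition _ := [SubChoice_isSubNzRing of val_ring by <:].

End ValuationRing.

Record involution (R : nzRingType) := Involution {
  inv_fun :> R -> R;
  invD : forall a b, inv_fun (a + b) = inv_fun a + inv_fun b;
  invM : forall a b, inv_fun (a * b) = inv_fun b * inv_fun a;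
  invK : involutive inv_fun
}.

Lemma inv0 (R : nzRingType) (s : involution R) : s 0 = 0.
Proof. by apply: (addIr (s 0)); rewrite -invD !add0r. Qed.

Lemma inv1 (R : nzRingType) (s : involution R) : s 1 = 1.
Proof. by rewrite -[LHS]mul1r -{1}[1](invK s) -invM mul1r invK. Qed.

Section ValuationRingInvolution.
Variables (K : nzRingType) (G : orderedZmodType) (v : valuation K G).
Variables (s : involution K) (vs : forall a, v (s a) = v a).

Fact val_ring_inv_subproof (a : val_ring v) : s (val a) \in val_ring_pred v.
Proof. by rewrite unfold_in vs; exact: (valP a). Qed.

Definition val_ring_inv_fun (a : val_ring v) : val_ring v :=
  Sub (s (val a)) (val_ring_inv_subproof a).

Fact val_ring_invD a b :
  val_ring_inv_fun (a + b) = val_ring_inv_fun a + val_ring_inv_fun b.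
Proof. by apply: val_inj; rewrite /= invD. Qed.

Fact val_ring_invM a b :
  val_ring_inv_fun (a * b) = val_ring_inv_fun b * val_ring_inv_fun a.
Proof. by apply: val_inj; rewrite /= invM. Qed.

Fact val_ring_invK : involutive val_ring_inv_fun.
Proof. by move=> a; apply: val_inj; rewrite /= invK. Qed.

Definition val_ring_inv : involution (val_ring v) :=
  Involution val_ring_invD val_ring_invM val_ring_invK.

Lemma val_ring_invE a : s (val a) = val (val_ring_inv a).
Proof. by []. Qed.

End ValuationRingInvolution.

Definition projective (R : nzRingType) (M : lmodType R) : Prop :=
  forall (N P : lmodType R) (p : {linear N -> P}) (f : {linear M -> P}),
    (forall y, exists x, p x = y) ->
    exists g : {linear M -> N}, forall x, p (g x) = f x.

Record hermitian_form (R : nzRingType) (s : involution R) (M : lmodType R)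
    (h : M -> M -> R) : Prop := HermitianForm {
  hermDl : forall x x' y, h (x + x') y = h x y + h x' y;
  hermDr : forall x y y', h x (y + y') = h x y + h x y';
  hermZ : forall a b x y, h (a *: x) (b *: y) = a * h x y * s b;
  herm_sym : forall x y, h x y = s (h y x)
}.

Record hermitian_space (R : nzRingType) (s : involution R) := HermitianSpace {
  herm_mod :> lmodType R;
  herm : herm_mod -> herm_mod -> R;
  herm_projective : projective herm_mod;
  hermP : hermitian_form s herm
}.

Section HermitianSpaces.
Variables (R : nzRingType) (s : involution R).

Section Adjoint.
Variables (V : hermitian_space s) (x : V).

Definition herm_adj_fun (y : V) : R^o := herm y x.

Fact herm_adj_linear : linear herm_adj_fun.
Proof.
move=> a y z; rewrite /herm_adj_fun (hermDl (hermP V)) -{1}[x]scale1r.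
by rewrite (hermZ (hermP V)) inv1 mulr1.
Qed.

HB.instance Definition _ :=
  GRing.isLinear.Build R V R^o *:%R herm_adj_fun herm_adj_linear.

Definition herm_adj : {linear V -> R^o} := herm_adj_fun.

End Adjoint.

Definition unimodular (V : hermitian_space s) : Prop := bijective (@herm_adj V).

Definition isometric (V V' : hermitian_space s) : Prop :=
  exists u : {linear V -> V'},
    bijective u /\ forall x y, herm (u x) (u y) = herm x y.

End HermitianSpaces.

Section Tensor.
Variables (S K : nzRingType) (i : {rmorphism S -> K}) (M : lmodType S).

(* The list [:: (a1, x1); ...; (an, xn)] represents a1 ⊗ x1 + ... + an ⊗ xn;
   [tensor_rel] is the congruence for concatenation presenting K ⊗_S M as a
   commutative monoid, K being a right S-module through i. *)
Inductive tensor_rel : seq (K * M) -> seq (K * M) -> Prop :=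
| tensor_refl t : tensor_rel t t
| tensor_sym t t' : tensor_rel t t' -> tensor_rel t' t
| tensor_trans t t' t'' :
    tensor_rel t t' -> tensor_rel t' t'' -> tensor_rel t t''
| tensor_cat t1 t1' t2 t2' : tensor_rel t1 t1' -> tensor_rel t2 t2' ->
    tensor_rel (t1 ++ t2) (t1' ++ t2')
| tensor_catC t1 t2 : tensor_rel (t1 ++ t2) (t2 ++ t1)
| tensor_0l x : tensor_rel [:: (0, x)] [::]
| tensor_Dl a b x : tensor_rel [:: (a + b, x)] [:: (a, x); (b, x)]
| tensor_Dr a x y : tensor_rel [:: (a, x + y)] [:: (a, x); (a, y)]
| tensor_balanced a c x : tensor_rel [:: (a * i c, x)] [:: (a, c *: x)].

Definition tensor_relb t t' : bool := `[< tensor_rel t t' >].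

Fact tensor_relb_refl : reflexive tensor_relb.
Proof. by move=> t; apply/asboolP; apply: tensor_refl. Qed.

Fact tensor_relb_sym : symmetric tensor_relb.
Proof. by move=> t t'; apply/asboolP/asboolP => /tensor_sym. Qed.

Fact tensor_relb_trans : transitive tensor_relb.
Proof.
move=> t2 t1 t3 /asboolP t12 /asboolP t23.
by apply/asboolP; apply: tensor_trans t12 t23.
Qed.

Canonical tensor_equiv :=
  EquivRel tensor_relb tensor_relb_refl tensor_relb_sym tensor_relb_trans.

Definition tensor := {eq_quot tensor_equiv}.

HB.instance Definition _ := Choice.on tensor.
HB.instance Definition _ := Quotient.on tensor.
HB.instance Definition _ : EqQuotient _ tensor_equiv tensor :=
  EqQuotient.on tensor.

Lemma tensor_piE t t' :
  \pi_tensor t = \pi_tensor t' <-> tensor_rel t t'.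
Proof.
split; first by move/eqP; rewrite eqmodE => /asboolP.
by move=> tt'; apply/eqP; rewrite eqmodE; apply/asboolP.
Qed.

Lemma tensor_repr t : tensor_rel (repr (\pi_tensor t)) t.
Proof. by apply/tensor_piE; rewrite reprK. Qed.

Definition pure (a : K) (x : M) : tensor := \pi_tensor [:: (a, x)].

Definition tensor_zero : tensor := \pi_tensor [::].
Definition tensor_add (u w : tensor) : tensor := \pi_tensor (repr u ++ repr w).
Definition tensor_scale (a : K) (u : tensor) : tensor :=
  \pi_tensor [seq (a * p.1, p.2) | p <- repr u].
Definition tensor_opp (u : tensor) : tensor := tensor_scale (-1) u.

Lemma tensor_rel_scale a t t' : tensor_rel t t' ->
  tensor_rel [seq (a * p.1, p.2) | p <- t] [seq (a * p.1, p.2) | p <- t'].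
Proof.
elim=> {t t'} /=; try by constructor.
- by move=> t t' t'' _ h _; apply: tensor_trans h.
- by move=> t1 t1' t2 t2' _ h1 _ h2; rewrite !map_cat; apply: tensor_cat.
- by move=> t1 t2; rewrite !map_cat; apply: tensor_catC.
- by move=> x; rewrite mulr0; apply: tensor_0l.
- by move=> b c x; rewrite mulrDr; apply: tensor_Dl.
- by move=> b c x; rewrite mulrA; apply: tensor_balanced.
Qed.

Lemma tensor_add_pi t t' :
  tensor_add (\pi_tensor t) (\pi_tensor t') = \pi_tensor (t ++ t').
Proof. by apply/tensor_piE; apply: tensor_cat; apply: tensor_repr. Qed.

Lemma tensor_scale_pi a t :
  tensor_scale a (\pi_tensor t) = \pi_tensor [seq (a * p.1, p.2) | p <- t].
Proof. by apply/tensor_piE; apply: tensor_rel_scale; apply: tensor_repr. Qed.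

Lemma tensor_quotP (P : tensor -> Prop) : (forall t, P (\pi_tensor t)) -> forall u, P u.
Proof. by move=> Ppi u; rewrite -[u]reprK. Qed.

Fact tensor_addA : associative tensor_add.
Proof.
by elim/tensor_quotP=> t; elim/tensor_quotP=> t'; elim/tensor_quotP=> t'';
  rewrite !tensor_add_pi catA.
Qed.

Fact tensor_addC : commutative tensor_add.
Proof.
elim/tensor_quotP=> t; elim/tensor_quotP=> t'; rewrite !tensor_add_pi.
by apply/tensor_piE; apply: tensor_catC.
Qed.

Fact tensor_add0 : left_id tensor_zero tensor_add.
Proof. by elim/tensor_quotP=> t; rewrite tensor_add_pi. Qed.

Fact tensor_scaleDl u a b :
  tensor_scale (a + b) u = tensor_add (tensor_scale a u) (tensor_scale b u).
Proof.
elim/tensor_quotP: u => t; rewrite !tensor_scale_pi tensor_add_pi.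
apply/tensor_piE; elim: t => [|[c x] t IHt] /=; first exact: tensor_refl.
rewrite mulrDl -cat1s -[X in tensor_rel _ X]cat1s.
apply: tensor_trans (tensor_cat (tensor_Dl _ _ _) IHt) _.
rewrite -cat1s -!catA; apply: tensor_cat; first exact: tensor_refl.
rewrite -[(b * c, x) :: map _ t]cat1s !catA.
by apply: tensor_cat; [apply: tensor_catC | apply: tensor_refl].
Qed.

Fact tensor_scale0l u : tensor_scale 0 u = tensor_zero.
Proof.
elim/tensor_quotP: u => t; rewrite tensor_scale_pi; apply/tensor_piE.
elim: t => [|[c x] t IHt] /=; first exact: tensor_refl.
by rewrite mul0r -cat1s -[[::]]cat0s; apply: tensor_cat (tensor_0l _) IHt.
Qed.

Fact tensor_scale1 : left_id 1 tensor_scale.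
Proof.
elim/tensor_quotP=> t; rewrite tensor_scale_pi -[in RHS](map_id t).
by congr \pi; apply: eq_map => -[c x] /=; rewrite mul1r.
Qed.

Fact tensor_addN : left_inverse tensor_zero tensor_opp tensor_add.
Proof.
move=> u; rewrite -[X in tensor_add _ X]tensor_scale1 -tensor_scaleDl addNr.
exact: tensor_scale0l.
Qed.

HB.instance Definition _ := GRing.isZmodule.Build tensor
  tensor_addA tensor_addC tensor_add0 tensor_addN.

Lemma tensor_piD t t' : \pi_tensor (t ++ t') = \pi_tensor t + \pi_tensor t'.
Proof. by rewrite -tensor_add_pi. Qed.

Fact tensor_scaleA a b u :
  tensor_scale a (tensor_scale b u) = tensor_scale (a * b) u.
Proof.
elim/tensor_quotP: u => t; rewrite !tensor_scale_pi -map_comp.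
by congr \pi; apply: eq_map => -[c x] /=; rewrite mulrA.
Qed.

Fact tensor_scaleDr : right_distributive tensor_scale +%R.
Proof.
move=> a; elim/tensor_quotP=> t; elim/tensor_quotP=> t'.
by rewrite -tensor_piD !tensor_scale_pi map_cat tensor_piD.
Qed.

HB.instance Definition _ := GRing.Zmodule_isLmodule.Build K tensor
  tensor_scaleA tensor_scale1 tensor_scaleDr tensor_scaleDl.

Lemma scale_pure a b x : a *: pure b x = pure (a * b) x.
Proof. exact: tensor_scale_pi. Qed.

Lemma pureDl a b x : pure (a + b) x = pure a x + pure b x.
Proof. by rewrite -tensor_piD; apply/tensor_piE; apply: tensor_Dl. Qed.

Lemma pureDr a x y : pure a (x + y) = pure a x + pure a y.
Proof. by rewrite -tensor_piD; apply/tensor_piE; apply: tensor_Dr. Qed.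

Lemma pure_balanced a c x : pure (a * i c) x = pure a (c *: x).
Proof. by apply/tensor_piE; apply: tensor_balanced. Qed.

Lemma tensor_ind (P : tensor -> Prop) : P 0 ->
  (forall a x u, P u -> P (pure a x + u)) -> forall u, P u.
Proof.
move=> P0 PD; elim/tensor_quotP; elim=> [|[a x] t IHt]; first exact: P0.
by rewrite -cat1s tensor_piD; apply: PD.
Qed.

Section Lift.
Variables (A : zmodType) (f : K -> M -> A).
Hypotheses (fDl : forall a b x, f (a + b) x = f a x + f b x)
  (fDr : forall a x y, f a (x + y) = f a x + f a y)
  (fB : forall a c x, f (a * i c) x = f a (c *: x)).

Definition tensor_lift (u : tensor) : A := \sum_(p <- repr u) f p.1 p.2.

Lemma tensor_rel_lift t t' : tensor_rel t t' ->
  \sum_(p <- t) f p.1 p.2 = \sum_(p <- t') f p.1 p.2.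
Proof.
elim=> {t t'}.
- by [].
- by [].
- by move=> t t' t'' _ -> _ ->.
- by move=> t1 t1' t2 t2' _ h1 _ h2; rewrite !big_cat h1 h2.
- by move=> t1 t2; rewrite !big_cat /= addrC.
- move=> x; rewrite big_seq1 big_nil /=.
  by apply: (addIr (f 0 x)); rewrite -fDl !add0r.
- by move=> a b x; rewrite !big_cons !big_nil !addr0 fDl.
- by move=> a x y; rewrite !big_cons !big_nil !addr0 fDr.
- by move=> a c x; rewrite !big_seq1 fB.
Qed.

Lemma tensor_lift_pi t : tensor_lift (\pi_tensor t) = \sum_(p <- t) f p.1 p.2.
Proof. by apply: tensor_rel_lift; apply: tensor_repr. Qed.

Lemma tensor_lift_pure a x : tensor_lift (pure a x) = f a x.
Proof. by rewrite tensor_lift_pi big_seq1. Qed.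

Lemma tensor_liftD u w : tensor_lift (u + w) = tensor_lift u + tensor_lift w.
Proof.
elim/tensor_quotP: u => t; elim/tensor_quotP: w => t'.
by rewrite -tensor_piD !tensor_lift_pi big_cat.
Qed.

Lemma tensor_lift0 : tensor_lift 0 = 0.
Proof. by rewrite tensor_lift_pi big_nil. Qed.

End Lift.

End Tensor.

(* The S-module obtained from a K-module by restriction along i; only used to
   show that extension of scalars preserves projectivity. *)
Section Restriction.
Variables (S K : nzRingType) (i : {rmorphism S -> K}).

Definition restr (N : lmodType K) : Type := N.

Section Module.
Variable N : lmodType K.
HB.instance Definition _ := GRing.Zmodule.on (restr N).

Definition restr_scale (c : S) (x : restr N) : restr N := i c *: (x : N).

Fact restr_scaleA a b x :
  restr_scale a (restr_scale b x) = restr_scale (a * b) x.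
Proof. by rewrite /restr_scale scalerA rmorphM. Qed.
Fact restr_scale1 : left_id 1 restr_scale.
Proof. by move=> x; rewrite /restr_scale rmorph1 scale1r. Qed.
Fact restr_scaleDr : right_distributive restr_scale +%R.
Proof. by move=> a x y; rewrite /restr_scale scalerDr. Qed.
Fact restr_scaleDl x : {morph restr_scale^~ x : a b / a + b}.
Proof. by move=> a b; rewrite /restr_scale rmorphD scalerDl. Qed.

HB.instance Definition _ := GRing.Zmodule_isLmodule.Build S (restr N)
  restr_scaleA restr_scale1 restr_scaleDr restr_scaleDl.
End Module.

Lemma tensor_projective (M : lmodType S) :
  projective M -> projective (tensor i M).
Proof.
move=> Mproj N P p f psurj.
pose p' (x : restr N) : restr P := p x.
have p'L : linear p' by move=> a x y; rewrite /p' linearP.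
pose f' (x : M) : restr P := f (pure i 1 x).
have f'L : linear f'.
  move=> a x y; rewrite /f' pureDr -pure_balanced mul1r -[i a]mulr1.
  by rewrite -scale_pure linearP.
pose p'' : {linear restr N -> restr P} :=
  HB.pack p' (GRing.isLinear.Build _ _ _ _ _ p'L).
pose f'' : {linear M -> restr P} :=
  HB.pack f' (GRing.isLinear.Build _ _ _ _ _ f'L).
have [g gE] := Mproj _ _ p'' f'' psurj.
pose l (a : K) (x : M) : N := a *: (g x : N).
have lDl a b x : l (a + b) x = l a x + l b x by rewrite /l scalerDl.
have lDr a x y : l a (x + y) = l a x + l a y by rewrite /l linearD scalerDr.
have lB a c x : l (a * i c) x = l a (c *: x) by rewrite /l linearZ -scalerA.
have lL : linear (tensor_lift (i := i) l).
  move=> a u w; rewrite tensor_liftD //; congr (_ + _).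
  elim/tensor_ind: u => [|b x u IHu].
    by rewrite scaler0 tensor_lift0 // scaler0.
  rewrite scalerDr !tensor_liftD // IHu scalerDr scale_pure !tensor_lift_pure //.
  by rewrite /l scalerA.
pose L : {linear tensor i M -> N} :=
  HB.pack (tensor_lift (i := i) l) (GRing.isLinear.Build _ _ _ _ _ lL).
have LE u : L u = tensor_lift l u by [].
exists L => u; rewrite LE; elim/tensor_ind: u => [|b x u IHu].
  by rewrite tensor_lift0 // !linear0.
rewrite tensor_liftD // !linearD IHu tensor_lift_pure // linearZ.
congr (_ + _); rewrite -[b in RHS]mulr1 -scale_pure linearZ; congr (_ *: _).
exact: (gE x).
Qed.

End Restriction.

Section BaseChange.
Variables (S K : nzRingType) (i : {rmorphism S -> K}).
Variables (s : involution S) (t : involution K).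
Hypothesis ti : forall a, t (i a) = i (s a).
Variable V : hermitian_space s.

Definition base_form (u w : tensor i V) : K :=
  \sum_(p <- repr u) \sum_(q <- repr w) p.1 * i (herm p.2 q.2) * t q.1.

Let hZl a (x y : V) : herm (a *: x) y = a * herm x y.
Proof. by rewrite -{1}[y]scale1r (hermZ (hermP V)) inv1 mulr1. Qed.

Let hZr a (x y : V) : herm x (a *: y) = herm x y * s a.
Proof. by rewrite -{1}[x]scale1r (hermZ (hermP V)) mul1r. Qed.

Lemma base_form_lift u w : base_form u w =
  tensor_lift (fun a x => tensor_lift (i := i)
    (fun b y => a * i (herm x y) * t b) w) u.
Proof. by []. Qed.

Let rDl a (x : V) b c y : a * i (herm x y) * t (b + c) =
  a * i (herm x y) * t b + a * i (herm x y) * t c.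
Proof. by rewrite invD mulrDr. Qed.

Let rDr a (x : V) b y z : a * i (herm x (y + z)) * t b =
  a * i (herm x y) * t b + a * i (herm x z) * t b.
Proof. by rewrite (hermDr (hermP V)) rmorphD mulrDr mulrDl. Qed.

Let rB a (x : V) b c y : a * i (herm x y) * t (b * i c) =
  a * i (herm x (c *: y)) * t b.
Proof. by rewrite hZr invM ti rmorphM !mulrA. Qed.

Let lDl a b (x : V) w :
  tensor_lift (i := i) (fun c y => (a + b) * i (herm x y) * t c) w =
  tensor_lift (fun c y => a * i (herm x y) * t c) w +
  tensor_lift (fun c y => b * i (herm x y) * t c) w.
Proof.
by rewrite -big_split; apply: eq_bigr => q _; rewrite !mulrDl.
Qed.

Let lDr a (x y : V) w :
  tensor_lift (i := i) (fun c z => a * i (herm (x + y) z) * t c) w =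
  tensor_lift (fun c z => a * i (herm x z) * t c) w +
  tensor_lift (fun c z => a * i (herm y z) * t c) w.
Proof.
rewrite -big_split; apply: eq_bigr => q _.
by rewrite (hermDl (hermP V)) rmorphD mulrDr mulrDl.
Qed.

Let lB a c (x : V) w :
  tensor_lift (i := i) (fun d y => a * i c * i (herm x y) * t d) w =
  tensor_lift (fun d y => a * i (herm (c *: x) y) * t d) w.
Proof.
by apply: eq_bigr => q _; rewrite hZl rmorphM !mulrA.
Qed.

Lemma base_formE a x b y :
  base_form (pure i a x) (pure i b y) = a * i (herm x y) * t b.
Proof.
by rewrite base_form_lift tensor_lift_pure // tensor_lift_pure.
Qed.

Lemma base_formDl u u' w : base_form (u + u') w = base_form u w + base_form u' w.
Proof. by rewrite !base_form_lift tensor_liftD. Qed.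

Lemma base_formDr u w w' : base_form u (w + w') = base_form u w + base_form u w'.
Proof.
rewrite !base_form_lift -big_split; apply: eq_bigr => p _.
by rewrite tensor_liftD.
Qed.

Let base_form0l w : base_form 0 w = 0.
Proof. by apply: (addIr (base_form 0 w)); rewrite -base_formDl !add0r. Qed.

Let base_form0r u : base_form u 0 = 0.
Proof. by apply: (addIr (base_form u 0)); rewrite -base_formDr !add0r. Qed.

Lemma base_form_hermitian : hermitian_form t base_form.
Proof.
split=> [u u' w|u w w'|a b u w|u w]; first exact: base_formDl.
- exact: base_formDr.
- elim/tensor_ind: u => [|c x u IHu].
    by rewrite scaler0 !base_form0l mulr0 mul0r.
  rewrite scalerDr !base_formDl IHu mulrDr mulrDl; congr (_ + _).
  elim/tensor_ind: w {IHu} => [|d y w IHw].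
    by rewrite scaler0 !base_form0r mulr0 mul0r.
  rewrite scalerDr !base_formDr IHw mulrDr mulrDl; congr (_ + _).
  by rewrite !scale_pure !base_formE invM !mulrA.
- elim/tensor_ind: u => [|c x u IHu].
    by rewrite base_form0l base_form0r inv0.
  rewrite base_formDl base_formDr invD IHu; congr (_ + _).
  elim/tensor_ind: w {IHu} => [|d y w IHw].
    by rewrite base_form0l base_form0r inv0.
  rewrite base_formDl base_formDr invD IHw; congr (_ + _).
  by rewrite !base_formE !invM invK ti -(herm_sym (hermP V)) mulrA.
Qed.

Definition base_change : hermitian_space t :=
  HermitianSpace (tensor_projective (@herm_projective _ _ V))
    base_form_hermitian.

End BaseChange.

(* Main.v *)
Require Import Defs.
From HB Require Import structures.
From mathcomp Require Import all_boot all_order all_algebra.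
From mathcomp Require Import boolp classical_sets.
From mathcomp Require Import multinomials.freeg.

Set Implicit Arguments.
Unset Strict Implicit.
Unset Printing Implicit Defensive.

Import Order.TTheory GRing.Theory.
Local Open Scope ring_scope.

(** Given an isometry [u] over K and a finite orthogonal basis [x_1, ..., x_n] of
    [V] with unit lengths, one modifies [u] by reflections until every [u x_j]
    lies in the lattice [V'].  If [u x_j] is not in [V'], write it as [p w] with
    [p] symmetric and [w] in [V'] primitive (this is where the symmetric elements
    of every value are used), choose [y] in [V'] orthogonal to the previous
    vectors with [h(w, y) = 1], and reflect along [w + p^-1 y].  An isometry
    mapping [V] into [V'] maps it onto [V'], because [V] is unimodular and hence
    splits off.

    Modules are not assumed finitely generated; that a unimodular projective
    module over the valuation ring has a finite orthogonal basis is a reflexivity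
    argument modulo the maximal ideal.  Functionals on the residue space lift to
    the module, so they are all represented by vectors.  For an infinite
    orthogonal sequence [x_n] of vectors of unit length, a functional sending
    every [x_n] to 1 and killing the vectors orthogonal to all [x_n] is
    represented by some [y]; a functional killing all [x_n] but not [y] is
    represented by some [t], which is orthogonal to all [x_n] but not to [y]. *)

(** * Dual bases of projective modules *)

Section DualBasis.
Variables (R : nzRingType) (M : lmodType R).

Lemma fglift_linear (N : lmodType R) (f : M -> N) :
  linear (fglift f : {freeg M / R} -> N).
Proof.
have fD D1 D2 : fglift f (D1 + D2 : {freeg M / R}) = fglift f D1 + fglift f D2.
  have fB := @lift_is_additive R M N f.
  have f0 : fglift f (0 : {freeg M / R}) = 0 by rewrite -(subrr 0) fB subrr.
  by rewrite -{1}[D2]opprK fB -[- D2]sub0r fB f0 sub0r opprK.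
have f0 : fglift f (0 : {freeg M / R}) = 0.
  by apply: (addIr (fglift f (0 : {freeg M / R}))); rewrite -fD !add0r.
move=> a D1 D2; rewrite fD; congr (_ + _).
have fS (I : Type) (s : seq I) (F : I -> {freeg M / R}) :
    fglift f (\sum_(i <- s) F i) = \sum_(i <- s) fglift f (F i).
  by elim/big_rec2: _ => // i y1 y2 _ <-; rewrite fD.
rewrite -{2}[D1]freeg_sumE fS scaler_sumr [_ *: D1]/GRing.scale /= /fgscale fS.
by apply: eq_bigr => e _; rewrite !liftU scalerA.
Qed.

HB.instance Definition _ (N : lmodType R) (f : M -> N) :=
  GRing.isLinear.Build R {freeg M / R} N *:%R (fglift f) (fglift_linear f).

Lemma fgliftE (N : lmodType R) (f : M -> N) (D : {freeg M / R}) :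
  fglift f D = \sum_(e <- dom D) coeff e D *: f e.
Proof.
by rewrite -{1}[D]freeg_sumE linear_sum; apply: eq_bigr => e _; rewrite /= liftU.
Qed.

(** A linear section of the evaluation map from the free module on all elements of [M]: [x] is the
    finite sum of the [coeff e (D x) *: e]. *)
Lemma dual_basis : projective M ->
  exists D : {linear M -> {freeg M / R}}, forall x, fglift id (D x) = x.
Proof.
move=> Mproj; apply: (Mproj {freeg M / R} M (fglift id) idfun) => y.
by exists (Freeg [:: (1, y)]); rewrite /= liftU scale1r.
Qed.

Definition submodule (U : set M) : Prop :=
  [/\ U 0, (forall x y, U x -> U y -> U (x + y)) & forall a x, U x -> U (a *: x)].

Lemma submodule_sum (U : set M) (I : eqType) (s : seq I) (F : I -> M) :
  submodule U -> (forall i, i \in s -> U (F i)) -> U (\sum_(i <- s) F i).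
Proof.
move=> [U0 UD _] UF; rewrite big_seq_cond; elim/big_rec: _ => // i x.
by rewrite andbT => /UF Ui Ux; apply: UD.
Qed.

Lemma projective_lift_mod (U : set M) (z : M) : projective M -> submodule U ->
  (forall x, exists c, U (x - c *: z)) ->
  exists g : {linear M -> R^o}, forall x, U (x - (g x : R) *: z).
Proof.
move=> /dual_basis[D DK] Usub /choice[c Uc].
(* The chosen [c] need not be linear on [M]; its extension to the free module is, and composing with
   the section [D] brings it back to [M]. *)
pose l : {linear {freeg M / R} -> R^o} := fglift (c : M -> R^o).
exists (l \o D) => x.
rewrite -{1}[x]DK /= /l !fgliftE scaler_suml -sumrB.
apply: submodule_sum => // e _; rewrite -[_ *: (c e : R^o)]/(_ * c e) -scalerA -scalerBr.
by case: Usub => _ _; apply.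
Qed.

End DualBasis.

(** * Arithmetic of the valuation ring and its maximal ideal *)

Section Valuation.
Variables (K : unitRingType) (G : orderedZmodType) (v : valuation K G).
Hypothesis K_division : forall a : K, a != 0 -> a \is a GRing.unit.
Implicit Types (a b c : K).

Lemma vle_total (x y : option G) : vle x y || vle y x.
Proof. by case: x y => [x|] [y|] //=; apply: oz_le_total. Qed.

Lemma vle_trans (x y z : option G) : vle x y -> vle y z -> vle x z.
Proof. by case: x y z => [x|] [y|] [z|] //=; apply: le_trans. Qed.

Lemma vleD2l (x y z : option G) : vle x y -> vle (vadd z x) (vadd z y).
Proof.
by case: x y z => [x|] [y|] [z|] //= xy; rewrite -!(addrC _ z) oz_leD2r.
Qed.

Lemma vaddC (x y : option G) : vadd x y = vadd y x.
Proof. by case: x y => [x|] [y|] //=; rewrite addrC. Qed.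

Lemma vaddA (x y z : option G) : vadd x (vadd y z) = vadd (vadd x y) z.
Proof. by case: x y z => [x|] [y|] [z|] //=; rewrite addrA. Qed.

Lemma vadd0 (x : option G) : vadd (Some 0) x = x.
Proof. by case: x => [x|] //=; rewrite add0r. Qed.

Lemma valN a : v (- a) = v a.
Proof. by rewrite -mulN1r Defs.valM Defs.valN1 vadd0. Qed.

Lemma val_divr a b : a != 0 -> vle (v a) (v b) -> a^-1 * b \in val_ring_pred v.
Proof.
move=> a0 /(vleD2l (v a^-1)).
by rewrite -!Defs.valM mulVr ?K_division // Defs.val1 unfold_in.
Qed.

(* Membership in the maximal ideal [{a | v a > 0}] of the valuation ring. *)
Definition small (a : K) : bool := ~~ vle (v a) (Some 0).

Lemma small_int a : small a -> a \in val_ring_pred v.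
Proof.
by rewrite unfold_in; have := vle_total (v a) (Some 0); rewrite /small; case: vle.
Qed.

Lemma small0 : small 0.
Proof. by rewrite /small ((val_infty v 0).2 erefl). Qed.

Lemma small1 : small 1 = false.
Proof. by rewrite /small Defs.val1 /= lexx. Qed.

Lemma smallN a : small (- a) = small a.
Proof. by rewrite /small valN. Qed.

Lemma smallD a b : small a -> small b -> small (a + b).
Proof.
rewrite /small /vmin; move=> sa sb; apply: contraNN (sa) => sab.
have := Defs.valD v a b; rewrite /vmin; case: ifP => _ h.
  exact: vle_trans h sab.
by case/negP: sb; apply: vle_trans h sab.
Qed.

Lemma smallB a b : small a -> small b -> small (a - b).
Proof. by move=> sa sb; rewrite smallD ?smallN. Qed.

Lemma smallMl a b : a \in val_ring_pred v -> small b -> small (a * b).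
Proof.
rewrite unfold_in => a0; apply: contraNN; rewrite Defs.valM => h.
have := vleD2l (v b) a0; rewrite vaddC vadd0 -(vaddC _ (v b)) => h'.
exact: vle_trans h' h.
Qed.

Lemma smallMr a b : b \in val_ring_pred v -> small a -> small (a * b).
Proof.
by move=> bi sa; rewrite /small Defs.valM vaddC -Defs.valM; apply: smallMl.
Qed.

Lemma small_sum (I : Type) (s : seq I) (P : pred I) (F : I -> K) :
  (forall i, P i -> small (F i)) -> small (\sum_(i <- s | P i) F i).
Proof. by move=> h; elim/big_ind: _ => // [|x y]; [apply: small0|apply: smallD]. Qed.

Lemma unit_neq0 a : ~~ small a -> a != 0.
Proof. by apply: contraNneq => ->; apply: small0. Qed.

Lemma unit_inv a : ~~ small a -> a^-1 \in val_ring_pred v.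
Proof.
move=> au; rewrite -[a^-1]mulr1; apply: val_divr; first exact: unit_neq0.
by rewrite Defs.val1; move: au; rewrite /small negbK.
Qed.

Lemma unitB a b : ~~ small a -> small b -> ~~ small (a + b).
Proof. by move=> au bs; apply: contraNN au => /smallB/(_ bs); rewrite addrK. Qed.

End Valuation.

(** * Formal rules for hermitian forms *)

Section HermitianTheory.
Variables (R : nzRingType) (s : involution R) (V : hermitian_space s).
Implicit Types (x y z : V) (a b : R).

Lemma hermZl a x y : herm (a *: x) y = a * herm x y.
Proof. by rewrite -{1}[y]scale1r (hermZ (hermP V)) Defs.inv1 mulr1. Qed.

Lemma hermZr a x y : herm x (a *: y) = herm x y * s a.
Proof. by rewrite -{1}[x]scale1r (hermZ (hermP V)) mul1r. Qed.

Lemma herm0l y : herm 0 y = 0.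
Proof. by rewrite -[0](scale0r (0 : V)) hermZl mul0r. Qed.

Lemma herm0r x : herm x 0 = 0.
Proof. by rewrite (herm_sym (hermP V)) herm0l Defs.inv0. Qed.

Lemma hermNl x y : herm (- x) y = - herm x y.
Proof. by rewrite -scaleN1r hermZl mulN1r. Qed.

Lemma invN a : s (- a) = - s a.
Proof. by apply/eqP; rewrite -addr_eq0 -Defs.invD addNr Defs.inv0. Qed.

Lemma hermNr x y : herm x (- y) = - herm x y.
Proof. by rewrite (herm_sym (hermP V)) hermNl invN -(herm_sym (hermP V)). Qed.

Lemma hermBl x y z : herm (x - y) z = herm x z - herm y z.
Proof. by rewrite (hermDl (hermP V)) hermNl. Qed.

Lemma hermBr x y z : herm x (y - z) = herm x y - herm x z.
Proof. by rewrite (hermDr (hermP V)) hermNr. Qed.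

Lemma unimodular_rep (f : {linear V -> R^o}) : unimodular V ->
  exists y, forall x, f x = herm x y.
Proof. by move=> [g _ gK]; exists (g f) => x; rewrite -{1}[f]gK. Qed.

Lemma unimodular_eq0 y : unimodular V -> (forall x, herm x y = 0) -> y = 0.
Proof.
move=> /bij_inj adj_inj y0; apply: adj_inj.
have E z : herm_adj z = herm_adj_fun z :> (V -> R^o) by [].
(* Functionals are bundled with proofs of linearity, so pointwise equality becomes equality through
   proof irrelevance. *)
have lin_ext (f g : {linear V -> R^o}) : f =1 g -> f = g.
  case: f g => f [[fD] [fZ]] [g [[gD] [gZ]]] /= /funext fg.
  by subst g; rewrite (Prop_irrelevance fD gD) (Prop_irrelevance fZ gZ).
by apply: lin_ext => x; rewrite !E /herm_adj_fun y0 herm0r.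
Qed.

End HermitianTheory.

(** * Projective modules over a valuation ring *)

Lemma exists_min (G : orderedZmodType) (T : eqType) (f : T -> option G)
    (r : seq T) x0 : x0 \in r ->
  exists2 x, x \in r & forall y, y \in r -> vle (f x) (f y).
Proof.
elim: r x0 => // x r IHr x0 _; case: r IHr => [_|x1 r /(_ x1)[|x2 x2r x2min]].
- exists x => [|y]; rewrite inE // => /eqP->.
  by case: (f x) => //= g; apply: lexx.
- by rewrite inE eqxx.
- have xx (o : option G) : vle o o by case: o => //= g; apply: lexx.
  case/orP: (vle_total (f x) (f x2)) => h.
    exists x => [|y]; rewrite inE ?eqxx // => /predU1P[->//|/x2min].
    exact: vle_trans.
  by exists x2 => [|y]; rewrite inE ?x2r ?orbT // => /predU1P[->|/x2min].
Qed.

Section ValuationModules.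
Variables (K : unitRingType) (G : orderedZmodType) (v : valuation K G).
Hypothesis K_division : forall a : K, a != 0 -> a \is a GRing.unit.

Local Notation S := (val_ring v).

Lemma val_ring_mulI (a b c : S) : a != 0 -> a * b = a * c -> b = c.
Proof.
move=> a0 /(congr1 val); rewrite !rmorphM => /(mulrI (K_division a0)).
exact: val_inj.
Qed.

Definition int_elt (a : K) (aO : a \in val_ring_pred v) : S :=
  exist (fun c => c \in val_ring_pred v) a aO.

Lemma scalar_dvdP (a b : K) : vle (v a) (v b) -> exists c : S, b = a * val c.
Proof.
have [->|a0] := eqVneq a 0 => ab.
  exists 0; rewrite mul0r; apply/(val_infty v).
  by move: ab; rewrite ((val_infty v 0).2 erefl); case: (v b).
by exists (int_elt (val_divr K_division a0 ab)); rewrite /= mulVKr ?K_division.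
Qed.

Lemma val_ring_dvdP (a b : S) : vle (v (val a)) (v (val b)) ->
  exists c, b = a * c.
Proof. by case/scalar_dvdP => c bE; exists c; apply: val_inj; rewrite rmorphM. Qed.

Lemma val_ring_unit (a : S) : ~~ small v (val a) ->
  exists b : S, a * b = 1 /\ b * a = 1.
Proof.
move=> au; exists (int_elt (unit_inv K_division au)).
by split; apply: val_inj; rewrite rmorphM /= ?mulrV ?mulVr ?K_division ?(unit_neq0 au).
Qed.

(* Dividing the coordinates of [x] in a dual basis by one of minimal valuation. *)
Lemma projective_primitive (M : lmodType S) (x : M) : projective M -> x != 0 ->
  exists a x0 (g : {linear M -> S^o}), x = a *: x0 /\ g x0 = 1.
Proof.
move=> /dual_basis[D DK] x0; pose f e := v (val (coeff e (D x))).
have : dom (D x) != [::].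
  by apply: contraNneq x0 => domx; rewrite -[x]DK fgliftE domx big_nil.
case domx: (dom (D x)) => [//|e1 r] _.
have: e1 \in dom (D x) by rewrite domx inE eqxx.
case/(exists_min f) => e0 e0x e0min.
have /choice[c cE] e : exists c : S, coeff e (D x) = coeff e0 (D x) * c.
  apply: val_ring_dvdP; have [/e0min//|ex] := boolP (e \in dom (D x)).
  have -> : coeff e (D x) = 0 by exact: coeff_outdom.
  by rewrite rmorph0 ((val_infty v 0).2 erefl).
pose g : {linear M -> S^o} :=
  (fglift (fun y => (y == e0)%:R : S^o) : {linear _ -> _}) \o D.
have gE y : g y = coeff e0 (D y) by [].
exists (coeff e0 (D x)), (\sum_(e <- dom (D x)) c e *: e), g.
have xE : x = coeff e0 (D x) *: \sum_(e <- dom (D x)) c e *: e.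
  rewrite -{1}[x]DK fgliftE scaler_sumr; apply: eq_bigr => e _.
  by rewrite scalerA -cE.
(* With [a] the coefficient at [e0], applying [g] to [x = a x0] gives [a = a g(x0)]; [a] is nonzero
   because [e0] lies in the support. *)
split=> //; apply: (@val_ring_mulI (coeff e0 (D x))); first by rewrite -mem_dom.
by rewrite mulr1 -[RHS]gE {3}xE linearZ.
Qed.

(* A subset maximal among the submodules containing [W] but not [z] is the
   kernel modulo the maximal ideal of the functional lifting [z |-> 1]. *)
Lemma residual_separation (M : lmodType S) (W : set M) (z : M) :
  projective M -> submodule W ->
  (forall a x, small v (val a) -> W (a *: x)) -> ~ W z ->
  exists g : {linear M -> S^o},
    (forall x, W x -> small v (val (g x : S))) /\ ~~ small v (val (g z : S)).
Proof.
move=> Mproj [W0 WD WZ] Wsmall Wz.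
(* Adjoining [W] inside the predicate, instead of asking that [A] contain it, lets the union of the
   empty chain qualify. *)
pose P (A : set M) := submodule (W `|` A)%classic /\ ~ A z.
have [F FP Ftot|U [[[U0 UD UZ] Uz] Umax]] := @Zorn_bigcup M P.
  split; last by move=> [X /FP[_]].
  split=> [|x y|a x]; first by left.
  - have mix X u w : F X -> W u -> X w -> (W `|` \bigcup_(X in F) X)%classic (u + w).
      move=> FX Wu Xw; have [[_ XD _] _] := FP _ FX.
      by case: (XD u w); [left|right|left|right; exists X].
    move=> [Wx|[X FX Xx]] [Wy|[Y FY Yy]]; first by left; apply: WD.
    + exact: mix FY _ _.
    + by rewrite addrC; apply: mix FX _ _.
    + have [XY|YX] := Ftot X Y FX FY.
        have [[_ YD _] _] := FP _ FY.
        by case: (YD x y); [right; apply: XY|right|left|right; exists Y].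
      have [[_ XD _] _] := FP _ FX.
      by case: (XD x y); [right|right; apply: YX|left|right; exists X].
  - move=> [Wx|[X FX Xx]]; first by left; apply: WZ.
    have [[_ _ XZ] _] := FP _ FX.
    by case: (XZ a x); [right|left|right; exists X].
pose V := (W `|` U)%classic.
have Vz : ~ V z by case.
have VZ a x : small v (val a) -> V (a *: x) by move=> ?; left; apply: Wsmall.
have Vsub : submodule V by [].
have VN x : V x -> V (- x) by rewrite -scaleN1r; apply: UZ.
(* For [x] outside [V], maximality puts [z] in [V + S x], say [z = u + c x]. A small [c] would give
   [z] in [V]; so [c] is a unit, and [x] is a multiple of [z] modulo [V]. *)
have Vgen x : exists c : S, V (x - c *: z).
  have [Vx|Vx] := pselect (V x); first by exists 0; rewrite scale0r subr0.
  pose U' := [set y | exists u c, V u /\ y = u + c *: x]%classic.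
  have U'V y : V y -> U' y by exists y, 0; rewrite scale0r addr0.
  have U'sub : submodule U'.
    split=> [|_ _ [u [c [Vu ->]]] [w [d [Vw ->]]]|a _ [u [c [Vu ->]]]].
    - exact: U'V.
    - by exists (u + w), (c + d); rewrite scalerDl addrACA; split=> //; apply: UD.
    - by exists (a *: u), (a * c); rewrite scalerDr scalerA; split=> //; apply: UZ.
  have [u [c [Vu zE]]] : U' z.
    apply: contrapT => U'z; apply: (Umax U'); last first.
      split=> //; rewrite (_ : W `|` U' = U')%classic //.
      by apply/seteqP; split=> y; [case=> // Wy; apply: U'V; left|right].
    split=> [y Uy|U'U]; first by apply: U'V; right.
    by apply: Vx; right; apply: U'U; exists 0, 1; rewrite add0r scale1r.
  have /val_ring_unit[b [_ bc]] : ~~ small v (val c).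
    apply/negP => cs; apply: Vz; rewrite zE; apply: UD => //; exact: VZ.
  exists b; rewrite zE scalerDr scalerA bc scale1r opprD addrCA subrr addr0.
  by apply/VN/UZ.
have [g gU] := projective_lift_mod Mproj Vsub Vgen.
exists g; split=> [x Wx|].
  (* If [g x] were a unit, then [(g x) z], congruent to [x] modulo [V], would force [z] into [V]. *)
  apply: contraPT isT => /val_ring_unit[b [_ bg]] _; apply: Vz.
  rewrite -[z]scale1r -bg -scalerA; apply: UZ.
  rewrite -[(g x : S) *: z](subKr x); apply: UD; first by left.
  exact: VN (gU x).
apply/negP => gz; apply: Vz; rewrite -[z](subrK ((g z : S) *: z)).
by apply: UD; [apply: gU|apply: VZ].
Qed.

End ValuationModules.

(** * Orthogonal bases of unimodular lattices *)

Section UnimodularLattices.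
Variables (K : unitRingType) (G : orderedZmodType) (v : valuation K G).
Hypothesis K_division : forall a : K, a != 0 -> a \is a GRing.unit.
Variables (s : involution K) (vs : forall a, v (s a) = v a).
Variable V : hermitian_space (val_ring_inv vs).

Local Notation S := (val_ring v).
Implicit Types (x y z : V) (X : seq V).

Lemma herm_zeroC x y : herm x y = 0 -> herm y x = 0.
Proof. by rewrite (herm_sym (hermP V)) => /(canRL (@invK _ _)) ->; rewrite Defs.inv0. Qed.

Lemma small_hermC x y : small v (val (herm x y)) = small v (val (herm y x)).
Proof. by rewrite (herm_sym (hermP V)) /small -val_ring_invE vs. Qed.

Fixpoint orthogonal_units X : Prop :=
  if X is x :: X' then
    [/\ ~~ small v (val (herm x x)), (forall y, y \in X' -> herm x y = 0)
      & orthogonal_units X']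
  else True.

(** Gram-Schmidt with invertible lengths. That [z] is in the span of [X] is expressed by quantifying
    over submodules, the form in which it gets applied. *)
Lemma orthogonal_projection X y : orthogonal_units X ->
  exists z, (forall U, submodule U -> (forall x, x \in X -> U x) -> U z) /\
    forall x, x \in X -> herm (y - z) x = 0.
Proof.
elim: X => [_|x X IHX [/(val_ring_unit K_division)[b [_ ba]] xX /IHX[z [zX yz]]]].
  by exists 0; split=> // U [].
exists (z + (herm (y - z) x * b) *: x); split=> [U Usub UX|x'].
  case: (Usub) => _ UD UZ; apply: UD; first by apply: zX => // w wX;
    apply: UX; rewrite inE wX orbT.
  by apply: UZ; apply: UX; rewrite inE eqxx.
rewrite inE; set c := herm (y - z) x * b.
rewrite opprD addrA hermBl hermZl => /predU1P[->|x'X].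
  by rewrite -mulrA ba mulr1 subrr.
by rewrite yz // xX // mulr0 subrr.
Qed.

Hypothesis V_unimodular : unimodular V.
Hypothesis v2 : v 2 = Some 0.

Lemma unimodular_primitive x : x != 0 ->
  exists a x0 y, x = a *: x0 /\ herm x0 y = 1.
Proof.
case/(projective_primitive K_division (@herm_projective _ _ V)).
move=> a [x0 [g [xE gx0]]]; have [y gE] := unimodular_rep g V_unimodular.
by exists a, x0, y; rewrite -gE.
Qed.

(** Dividing [x] by a scalar gives [x0] with a partner [w] orthogonal to [X] and [h(x0, w) = 1]. If
    neither has unit length, [h(x0 + w, x0 + w)] is 2 plus a small element, a unit since
    [v 2 = Some 0]. *)
Lemma orthogonal_units_extend X x : orthogonal_units X -> x != 0 ->
  (forall y, y \in X -> herm x y = 0) -> exists x', orthogonal_units (x' :: X).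
Proof.
move=> Xorth x_neq0 xX.
have [a [x0 [y [xE x0y]]]] := unimodular_primitive x_neq0.
have a0 : a != 0 by apply: contraNneq x_neq0 => a0; rewrite xE a0 scale0r.
have x0X w : w \in X -> herm x0 w = 0.
  move=> wX; apply: (val_ring_mulI K_division a0).
  by rewrite mulr0 -hermZl -xE xX.
have [z [zX yzX]] := orthogonal_projection y Xorth.
have x0z : herm x0 z = 0.
  apply: (zX (fun z => herm x0 z = 0)) => //; split=> [|w w' h h'|c w h].
  - exact: herm0r.
  - by rewrite (hermDr (hermP V)) h h' addr0.
  - by rewrite hermZr h mul0r.
have x0yz : herm x0 (y - z) = 1 by rewrite hermBr x0y x0z subr0.
have yzx0 : herm (y - z) x0 = 1 by rewrite (herm_sym (hermP V)) x0yz Defs.inv1.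
move: {z zX x0z} (y - z) yzX x0yz yzx0 => w wX x0w wx0.
have [sx|] := boolP (small v (val (herm x0 x0))); last by exists x0.
have [sw|] := boolP (small v (val (herm w w))); last by exists w.
exists (x0 + w); split=> // [|u uX]; last first.
  by rewrite (hermDl (hermP V)) x0X // wX // addr0.
rewrite (hermDl (hermP V)) !(hermDr (hermP V)) x0w wx0.
rewrite [_ + 1]addrC addrACA !rmorphD rmorph1.
apply: unitB; last by rewrite smallD.
by rewrite /small v2 /= lexx.
Qed.

Lemma finite_orthogonal_basis :
  exists X, orthogonal_units X /\
    forall x, (forall y, y \in X -> herm x y = 0) -> x = 0.
Proof.
apply: contrapT => noX.
have /choice[next nextP] X :
    exists x, orthogonal_units X -> orthogonal_units (x :: X).
  (* The value 0 is a default for lists that are not orthogonal. *)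
  have [Xorth|] := pselect (orthogonal_units X); last by exists 0.
  have [x [xX x0]] : exists x, (forall y, y \in X -> herm x y = 0) /\ x != 0.
    apply: contrapT => nox; apply: noX; exists X; split=> // x xX.
    by apply/eqP; apply/negP => /negP x0; apply: nox; exists x.
  by have [x' ?] := orthogonal_units_extend Xorth x0 xX; exists x'.
pose Xs n := iter n (fun X => next X :: X) [::].
pose xs n := next (Xs n).
have Xs_orth n : orthogonal_units (Xs n) by elim: n => //= n; apply: nextP.
have xs_unit n : ~~ small v (val (herm (xs n) (xs n))).
  by case: (Xs_orth n.+1).
have xsXs m n : (n < m)%N -> xs n \in Xs m.
  elim: m => // m IHm; rewrite ltnS leq_eqVlt => /predU1P[->|/IHm nm] /=.
    by rewrite inE eqxx.
  by rewrite inE nm orbT.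
have xs_orth m n : m != n -> herm (xs m) (xs n) = 0.
  rewrite neq_ltn; case/orP => h.
    by apply: herm_zeroC; case: (Xs_orth n.+1) => _ + _; apply; apply: xsXs.
  by case: (Xs_orth m.+1) => _ + _; apply; apply: xsXs.
have /choice[b bP] n : exists b : S, herm (xs n) (xs n) * b = 1.
  by have [b []] := val_ring_unit K_division (xs_unit n); exists b.
(* The sum of the first [m] Fourier coefficients of [x]: equal to 1 on [x_n] once [m > n], and to 0
   on vectors orthogonal to the sequence. *)
pose sums x m : S := \sum_(n < m) herm x (xs n) * b n.
have sumsB x y m : sums (x - y) m = sums x m - sums y m.
  by rewrite /sums -sumrB; apply: eq_bigr => n _; rewrite hermBl mulrBl.
have sums_xs n m : (n < m)%N -> sums (xs n) m = 1.
  move=> nm; rewrite /sums (bigD1 (Ordinal nm)) //= bP big1 ?addr0 // => k.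
  by rewrite -val_eqE /= eq_sym => /xs_orth->; rewrite mul0r.
pose eventually_small (f : V -> nat -> S) : set V :=
  fun x => exists k, forall m, (k <= m)%N -> small v (val (f x m)).
have ev_sub f : (forall m, linear (f^~ m : V -> S^o)) ->
    submodule (eventually_small f) /\
    forall a x, small v (val a) -> eventually_small f (a *: x).
  move=> f_lin.
  have fD x y m : f (x + y) m = f x m + f y m.
    by have := f_lin m 1 x y; rewrite !scale1r.
  have f0 m : f 0 m = 0 by apply: (addIr (f 0 m)); rewrite -fD !add0r.
  have fZ a x m : f (a *: x) m = a * f x m.
    by have := f_lin m a x 0; rewrite !addr0 f0 addr0.
  split; first split.
  - by exists 0%N => m _; rewrite f0 rmorph0 small0.
  - move=> x y [k kx] [l ly]; exists (maxn k l) => m.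
    rewrite geq_max => /andP[/kx fx /ly fy].
    by rewrite fD rmorphD smallD.
  - move=> a x [k kx]; exists k => m /kx fx.
    by rewrite fZ rmorphM smallMl // (valP a).
  - by move=> a x sa; exists 0%N => m _; rewrite fZ rmorphM smallMr // (valP (f x m)).
have Vproj := @herm_projective _ _ V.
have [W0sub W0small] : submodule (eventually_small sums) /\
    forall a x, small v (val a) -> eventually_small sums (a *: x).
  apply: ev_sub => m a x y; rewrite /sums scaler_sumr -big_split /=.
  by apply: eq_bigr => n _; rewrite (hermDl (hermP V)) hermZl mulrDl -mulrA.
(* Vectors with eventually small [sums] include every [x_n - x_0] but not [x_0], so [g] takes unit
   values on the whole sequence. *)
have [|g [gW0 gx0]] := residual_separation K_division (z := xs 0) Vproj W0sub W0small.
  by move=> [k /(_ k.+1 (leqnSn _))]; rewrite sums_xs // rmorph1 small1.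
have [y gE] := unimodular_rep g V_unimodular.
have xs_y n : ~~ small v (val (herm (xs n) y)).
  rewrite -[xs n](subrK (xs 0)) (hermDl (hermP V)) rmorphD addrC -gE.
  apply: unitB => //; rewrite -gE; apply: gW0; exists n.+1 => m nm.
  by rewrite sumsB !sums_xs ?subrr ?rmorph0 ?small0 //; apply: leq_trans nm.
pose pairing x n := herm x (xs n).
have [W1sub W1small] : submodule (eventually_small pairing) /\
    forall a x, small v (val a) -> eventually_small pairing (a *: x).
  by apply: ev_sub => m a x z; rewrite /pairing (hermDl (hermP V)) hermZl.
(* Each [x_n] pairs to 0 with all later terms, whereas [y] pairs to a unit with every term. *)
have [|f [fW1 fy]] := residual_separation K_division (z := y) Vproj W1sub W1small.
  by move=> [k /(_ k (leqnn _))]; rewrite /pairing small_hermC (negbTE (xs_y k)).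
have [t fE] := unimodular_rep f V_unimodular.
have xs_t n : small v (val (herm (xs n) t)).
  rewrite -fE; apply: fW1; exists n.+1 => m nm.
  by rewrite /pairing xs_orth ?rmorph0 ?small0 // neq_ltn nm.
(* All [h(x_n, t)] are small, hence so are the [sums] of [t]; then [h(t, y) = g t] is small, against
   the choice of [f]. *)
case/negP: fy; rewrite fE small_hermC -gE; apply: gW0; exists 0%N => m _.
rewrite /sums rmorph_sum; apply: small_sum => n _.
by rewrite rmorphM smallMr ?(valP (b n)) // small_hermC.
Qed.

End UnimodularLattices.

(** * Reflections *)

Section Reflection.
Variables (K : unitRingType) (s : involution K) (W : hermitian_space s).
Variable e : W.
Hypothesis e_unit : herm e e \is a GRing.unit.
Implicit Types x y : W.

Let c := (herm e e)^-1 *+ 2.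

Definition reflection x : W := x - (herm x e * c) *: e.

Fact reflection_linear : linear reflection.
Proof.
move=> a x y; rewrite /reflection (hermDl (hermP W)) hermZl mulrDl scalerDl.
by rewrite -mulrA -scalerA scalerBr addrACA opprD.
Qed.

HB.instance Definition _ :=
  GRing.isLinear.Build K W W *:%R reflection reflection_linear.

Let c_sym : s c = c.
Proof.
rewrite /c mulr2n Defs.invD; suff -> : s (herm e e)^-1 = (herm e e)^-1 by [].
apply: (mulIr e_unit); rewrite mulVr // {2}(herm_sym (hermP W)).
by rewrite -Defs.invM mulrV // Defs.inv1.
Qed.

Let c_herm : c * herm e e = 2.
Proof. by rewrite /c mulrnAl mulVr. Qed.

Let herm_reflection_e x : herm (reflection x) e = - herm x e.
Proof.
by rewrite hermBl hermZl -mulrA c_herm mulr_natr mulr2n opprD addrA subrr sub0r.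
Qed.

Lemma reflectionK : involutive reflection.
Proof.
move=> x; rewrite {1}/reflection herm_reflection_e mulNr scaleNr opprK.
by rewrite /reflection subrK.
Qed.

(** As [c] is symmetric, expanding the second argument adds [h(x, e) c h(e, y)] and expanding the
    first removes it. *)
Lemma herm_reflection x y : herm (reflection x) (reflection y) = herm x y.
Proof.
rewrite {2}/reflection hermBr hermZr herm_reflection_e Defs.invM c_sym.
rewrite -(herm_sym (hermP W)) hermBl hermZl mulNr opprK mulrA.
by rewrite subrK.
Qed.

Lemma reflection_fix x : herm x e = 0 -> reflection x = x.
Proof. by rewrite /reflection => ->; rewrite mul0r scale0r subr0. Qed.

End Reflection.

(** * A reflection clearing the denominator of a vector *)

Section ReflectIntoLattice.
Variables (K : unitRingType) (G : orderedZmodType) (v : valuation K G).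
Hypothesis K_division : forall a : K, a != 0 -> a \is a GRing.unit.
Hypothesis v2 : v 2 = Some 0.
Variables (s : involution K) (W : hermitian_space s).

(* With [t = p^-1], [a = h(p w, p w)], [d = h(y, y)] and [e = w + t y], one
   finds [h(e, e) = t (2 + (a + d) t)], and the coordinates of the reflection of
   [p w] along [e] lose the factor [p]. *)
Lemma reflect_into_lattice (w y : W) (p : K) : p != 0 -> s p = p ->
  small v p^-1 -> herm w y = 1 ->
  herm (p *: w) (p *: w) \in val_ring_pred v ->
  herm y y \in val_ring_pred v ->
  let e := w + p^-1 *: y in
  herm e e \is a GRing.unit /\
  exists c1 c2, [/\ c1 \in val_ring_pred v, c2 \in val_ring_pred v
    & reflection e (p *: w) = c1 *: w + c2 *: y].
Proof.
move=> p0 sp; set t := p^-1 => ts wy; set a := herm (p *: w) _.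
set d := herm y y => aO dO e.
have pU := K_division p0.
have tp : t * p = 1 by rewrite mulVr.
have pt : p * t = 1 by rewrite mulrV.
have st : s t = t by apply: (mulIr pU); rewrite -{1}sp -Defs.invM pt tp Defs.inv1.
have yw : herm y w = 1 by rewrite (herm_sym (hermP W)) wy Defs.inv1.
have wE : herm w w = t * a * t.
  by rewrite /a hermZl hermZr sp !mulrA tp mul1r -mulrA pt mulr1.
pose n := 2 + (a + d) * t.
have nU : ~~ small v n.
  by apply: unitB; [rewrite /small v2 /= lexx | rewrite smallMl ?rpredD].
have nunit := K_division (unit_neq0 nU).
have eE : herm e e = t * n.
  rewrite /e (hermDl (hermP W)) !(hermDr (hermP W)) !hermZl !hermZr st wE wy yw.
  rewrite -/d mul1r mulr1 /n mulrDl !mulrDr mulr1 !mulrA.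
  by rewrite [t * a * t + t]addrC addrACA.
have tU : t \is a GRing.unit by rewrite unitrV.
have eU : herm e e \is a GRing.unit by rewrite eE unitrMr.
split=> //.
have cE : (herm e e)^-1 *+ 2 = n^-1 * p *+ 2 by rewrite eE invrM // /t invrK.
have peE : herm (p *: w) e = 1 + a * t.
  rewrite hermZl /e (hermDr (hermP W)) hermZr wE wy mul1r st mulrDr pt.
  by rewrite !mulrA pt mul1r addrC.
have nVO := unit_inv K_division nU.
have tO := small_int ts.
(* Here [h(p w, e) = 1 + a t] and [h(e, e)^-1 = n^-1 p]. With [p = n n^-1 p], the coefficient of [w]
   is [(n - 2 (1 + a t)) n^-1 p], whose first factor is [(d - a) t]. *)
exists ((d - a) * (t * n^-1 * p)), (- ((1 + a * t) * (n^-1 *+ 2))); split.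
(* [t n^-1 p] is a conjugate of [n^-1], so it has the same value, the value group being abelian. *)
- rewrite rpredM ?rpredB // unfold_in !Defs.valM -vaddA vaddC -vaddA -Defs.valM.
  by rewrite pt Defs.val1 vaddC vadd0 -unfold_in.
- by rewrite rpredN rpredM ?rpredD ?rpredM ?rpred1 ?rpredMn.
rewrite /reflection peE cE /e scalerDr opprD addrA -scalerBl; congr (_ *: _ + _).
  have nE : n - (1 + a * t) *+ 2 = (d - a) * t.
    by rewrite mulrnDl opprD addrA [n]addrC addrK mulrDl mulrBl mulr2n opprD
      addrA [a * t + _]addrC addrK.
  by rewrite !mulrA -nE !mulrBl mulrV // mul1r mulrnAr !mulrnAl !mulrA.
by rewrite scalerA -scaleNr; congr (- _ *: _); rewrite -mulrA mulrnAl -mulrA pt mulr1.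
Qed.

End ReflectIntoLattice.

(** * Lattices in their scalar extensions, and moving an isometry into a lattice *)

Section Extension.
Variables (K : unitRingType) (G : orderedZmodType) (v : valuation K G).
Hypothesis K_division : forall a : K, a != 0 -> a \is a GRing.unit.
Variables (s : involution K) (vs : forall a, v (s a) = v a).

Local Notation S := (val_ring v).
Local Notation "V '_K'" := (base_change (val_ring_invE vs) V)
  (at level 8, format "V '_K'").

Section OneSpace.
Variable V : hermitian_space (val_ring_inv vs).

Definition lattice_vec (x : V) : V _K := pure _ 1 x.

Fact lattice_vecD x y : lattice_vec (x + y) = lattice_vec x + lattice_vec y.
Proof. exact: pureDr. Qed.

Lemma lattice_vecZ a x : lattice_vec (a *: x) = val a *: lattice_vec x.
Proof.
rewrite /lattice_vec -pure_balanced mul1r.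
by rewrite -[RHS]/(_ *: pure _ _ _) scale_pure mulr1.
Qed.

Lemma lattice_vec0 : lattice_vec 0 = 0.
Proof. by rewrite -(scale0r (0 : V)) lattice_vecZ rmorph0 scale0r. Qed.

Lemma pure_lattice_vec a x : pure _ a x = a *: lattice_vec x.
Proof. by rewrite -[RHS]/(_ *: pure _ _ _) scale_pure mulr1. Qed.

Lemma herm_lattice_vec x y :
  herm (lattice_vec x) (lattice_vec y) = val (herm x y).
Proof.
by have := base_formE (val_ring_invE vs) 1 x 1 y; rewrite Defs.inv1 mulr1 mul1r.
Qed.

(** Of two scalars, one divides the other on the left, and [a x + (a c) y = a (x + c y)] merges the
    two terms. *)
Lemma base_change_pure (w : V _K) : exists a x, w = a *: lattice_vec x.
Proof.
elim/tensor_ind: w => [|a x _ [b [y ->]]]; first by exists 0, 0; rewrite scale0r.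
rewrite pure_lattice_vec; case/orP: (vle_total (v a) (v b)) => /(scalar_dvdP K_division)[c ->].
  by exists a, (x + c *: y); rewrite lattice_vecD lattice_vecZ scalerDr scalerA.
by exists b, (c *: x + y); rewrite lattice_vecD lattice_vecZ scalerDr scalerA.
Qed.

Hypothesis V_unimodular : unimodular V.

(** The extended form restricts to the nondegenerate form of [V]. *)
Lemma lattice_vec_inj : injective lattice_vec.
Proof.
move=> x y xy; apply/eqP; rewrite -subr_eq0; apply/eqP.
apply: (unimodular_eq0 V_unimodular) => z; apply: val_inj.
by rewrite hermBr rmorphB /= -!herm_lattice_vec xy subrr.
Qed.

Hypothesis v_sym : forall g : G, exists a : K, v a = Some g /\ a = s a.

(** Write [w = d x'] with [x'] primitive and take a symmetric [p] of the same value as [d]; the unit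
    [c] with [d = p c] is absorbed into the vector. *)
Lemma base_change_primitive (w : V _K) : w != 0 ->
  exists p x y, [/\ p != 0, s p = p, w = p *: lattice_vec x & herm x y = 1].
Proof.
have [a [x ->]] := base_change_pure w => ax0.
have x0 : x != 0.
  by apply: contraNneq ax0 => ->; rewrite lattice_vec0 scaler0.
have [b [x' [y [xE x'y]]]] := unimodular_primitive K_division V_unimodular x0.
move: ax0; rewrite xE lattice_vecZ scalerA; set d := a * val b => dx0.
have d0 : d != 0 by apply: contraNneq dx0 => ->; rewrite scale0r.
case vd: (v d) => [g|]; last by case/eqP: d0; apply/(val_infty v).
have [p [vp sp]] := v_sym g.
have p0 : p != 0 by apply/eqP => /(val_infty v); rewrite vp.
have [c dE] : exists c : S, d = p * val c.
  by apply: (scalar_dvdP K_division); rewrite vp vd /= lexx.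
have [c' [cc' _]] : exists c' : S, c * c' = 1 /\ c' * c = 1.
  apply: val_ring_unit => //; have := vd; rewrite dE Defs.valM vp /small.
  case: (v (val c)) => //= h [/eqP].
  by rewrite -subr_eq0 addrAC subrr add0r => /eqP ->; rewrite lexx.
(* The involution on [c'] undoes the one in the second argument, leaving [c c' = 1]. *)
exists p, (c *: x'), (val_ring_inv vs c' *: y); split=> //.
  by rewrite dE lattice_vecZ scalerA.
by rewrite hermZl hermZr x'y mul1r invK.
Qed.

End OneSpace.

Lemma orthogonal_units_map (V V' : hermitian_space (val_ring_inv vs))
    (f : V -> V') (X : seq V) :
  (forall x y, x \in X -> y \in X -> herm (f x) (f y) = herm x y) ->
  orthogonal_units X -> orthogonal_units (map f X).
Proof.
elim: X => //= x X IHX fX [xu xX Xorth]; split.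
- by rewrite fX // inE eqxx.
- by move=> _ /mapP[y yX ->]; rewrite fX ?xX // inE ?eqxx ?yX ?orbT.
- by apply: IHX => // y z yX zX; rewrite fX // inE ?yX ?zX orbT.
Qed.

Definition isometry (R : nzRingType) (t : involution R)
    (W W' : hermitian_space t) (u : W -> W') : Prop :=
  bijective u /\ forall x y, herm (u x) (u y) = herm x y.

Section Isometries.
Variables V V' : hermitian_space (val_ring_inv vs).
Hypothesis V'_unimodular : unimodular V'.
Hypothesis v2 : v 2 = Some 0.
Hypothesis v_sym : forall g : G, exists a : K, v a = Some g /\ a = s a.

Lemma isometry_into_lattice (u : {linear V _K -> V' _K}) (X : seq V) :
  isometry u -> orthogonal_units X ->
  exists u' : {linear V _K -> V' _K}, isometry u' /\
    forall x, x \in X -> exists y, u' (lattice_vec x) = lattice_vec y.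
Proof.
move=> u_iso; elim: X => [_|x X IHX /= [xu xX Xorth]]; first by exists u.
have [{u_iso IHX}u [[u_bij u_herm] uX]] := IHX Xorth.
have uwE : herm (u (lattice_vec x)) (u (lattice_vec x)) = val (herm x x).
  by rewrite u_herm herm_lattice_vec.
(* The image of [x] is nonzero because its length is a unit. *)
have /(base_change_primitive V'_unimodular v_sym)[p [w [y [p0 sp uxE wy]]]] :
    u (lattice_vec x) != 0.
  apply: contraNneq xu => ux0; move: uwE; rewrite ux0 herm0l => <-.
  exact: small0.
have /choice[f fE] z : exists z', z \in X -> u (lattice_vec z) = lattice_vec z'.
  have [/uX[z' ?]|_] := boolP (z \in X); [by exists z' | by exists 0].
have [pO|pO] := boolP (p \in val_ring_pred v).
  exists u; split=> // z; rewrite inE => /predU1P[->|/uX//].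
  exists (int_elt pO *: w).
  by rewrite lattice_vecZ uxE.
have fX_orth : orthogonal_units (map f X).
  apply: orthogonal_units_map => // z z' zX z'X; apply: val_inj.
  by rewrite -!herm_lattice_vec -!fE // u_herm.
have [y' [y'X yfX]] := orthogonal_projection K_division y fX_orth.
have wfX z : z \in X -> herm w (f z) = 0.
  move=> zX; apply: val_inj; apply: (mulrI (K_division p0)).
  rewrite -herm_lattice_vec -hermZl -uxE -fE // u_herm herm_lattice_vec xX //.
  by rewrite rmorph0 mulr0.
(* As [w] is orthogonal to the images [f z], subtracting the projection [y'] from [y] preserves
   [h(w, y) = 1]. *)
have wy' : herm w y' = 0.
  apply: (y'X (fun z => herm w z = 0)) => [|_ /mapP[z zX ->]]; last exact: wfX.
  split=> [|z z' h h'|c z h]; first exact: herm0r.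
    by rewrite (hermDr (hermP V')) h h' addr0.
  by rewrite hermZr h mul0r.
have {y wy y' y'X wy' yfX}[y wy yX] : exists2 y, herm w y = 1 &
    forall z, z \in X -> herm (f z) y = 0.
  exists (y - y'); first by rewrite hermBr wy wy' subr0.
  by move=> z zX; apply: herm_zeroC; apply: yfX; apply: map_f.
have p_small : small v p^-1.
  by apply: contraNT pO => /(unit_inv K_division); rewrite invrK.
have [|||e_unit [c1 [c2 [c1O c2O reflE]]]] :=
  reflect_into_lattice K_division v2 (w := lattice_vec w) (y := lattice_vec y) p0 sp p_small.
- by rewrite herm_lattice_vec wy rmorph1.
- by rewrite -uxE uwE (valP (herm x x)).
- by rewrite herm_lattice_vec (valP (herm y y)).
set e := _ + _ in e_unit reflE.
(* Both [w] and [y] are orthogonal to the earlier images, so the reflection fixes these. *)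
have e_orth z : z \in X -> herm (u (lattice_vec z)) e = 0.
  move=> zX; rewrite fE // (hermDr (hermP _)) hermZr !herm_lattice_vec yX //.
  by rewrite (herm_zeroC (wfX z zX)) rmorph0 mul0r addr0.
exists (reflection e \o u); split; first split.
- by apply: bij_comp => //; exists (reflection e); apply: reflectionK.
- by move=> a b; rewrite -u_herm; apply: (herm_reflection e_unit).
move=> z; rewrite inE => /predU1P[->|zX]; last first.
  by exists (f z); rewrite /= reflection_fix ?e_orth // fE.
exists (int_elt c1O *: w + int_elt c2O *: y).
by rewrite lattice_vecD !lattice_vecZ /= uxE reflE.
Qed.

End Isometries.
End Extension.

(** * Functoriality of scalar extension *)

Section TensorMap.
Variables (S K : nzRingType) (i : {rmorphism S -> K}) (M N : lmodType S).
Variable f : {linear M -> N}.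

Definition tensor_map : tensor i M -> tensor i N :=
  tensor_lift (fun a x => pure i a (f x)).

Let pDl a b x : pure i (a + b) (f x) = pure i a (f x) + pure i b (f x).
Proof. exact: pureDl. Qed.

Let pDr a x y : pure i a (f (x + y)) = pure i a (f x) + pure i a (f y).
Proof. by rewrite linearD pureDr. Qed.

Let pB a c x : pure i (a * i c) (f x) = pure i a (f (c *: x)).
Proof. by rewrite linearZ pure_balanced. Qed.

Lemma tensor_map_pure a x : tensor_map (pure i a x) = pure i a (f x).
Proof. by rewrite /tensor_map tensor_lift_pure. Qed.

Lemma tensor_mapD u w : tensor_map (u + w) = tensor_map u + tensor_map w.
Proof. by rewrite /tensor_map tensor_liftD. Qed.

Lemma tensor_map0 : tensor_map 0 = 0.
Proof. by rewrite /tensor_map tensor_lift0. Qed.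

Fact tensor_map_linear : linear tensor_map.
Proof.
move=> a u w; rewrite tensor_mapD; congr (_ + _).
elim/tensor_ind: u => [|b x u IHu]; first by rewrite scaler0 tensor_map0 scaler0.
by rewrite scalerDr !tensor_mapD scalerDr IHu scale_pure !tensor_map_pure scale_pure.
Qed.

HB.instance Definition _ :=
  GRing.isLinear.Build K (tensor i M) (tensor i N) *:%R tensor_map
    tensor_map_linear.

End TensorMap.

Arguments tensor_map {S K} i {M N} f u.

Lemma tensor_map_can (S K : nzRingType) (i : {rmorphism S -> K})
    (M N : lmodType S) (f : {linear M -> N}) (g : {linear N -> M}) :
  cancel f g -> cancel (tensor_map i f) (tensor_map i g).
Proof.
move=> fK; elim/tensor_ind=> [|a x u IHu]; first by rewrite !tensor_map0.
by rewrite !tensor_mapD IHu !tensor_map_pure fK.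
Qed.

(** The inverse of a linear bijection is linear, so both extend to mutually inverse maps; the forms
    are compared on pure tensors. *)
Lemma isometric_base_change (S K : nzRingType) (i : {rmorphism S -> K})
    (s : involution S) (t : involution K) (ti : forall a, t (i a) = i (s a))
    (V V' : hermitian_space s) :
  isometric V V' -> isometric (base_change ti V) (base_change ti V').
Proof.
move=> [f [[g fK gK] f_herm]].
have gL : linear g by move=> a x y; apply: (can_inj fK); rewrite gK linearP !gK.
pose g' : {linear V' -> V} := HB.pack g (GRing.isLinear.Build _ _ _ _ _ gL).
exists (tensor_map i f); split.
  by exists (tensor_map i g'); apply: tensor_map_can.
move=> u w.
change (base_form t (tensor_map i f u) (tensor_map i f w) = base_form t u w).
have B0l (U : hermitian_space s) z : base_form t (0 : tensor i U) z = 0.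
  exact: (herm0l (V := base_change ti U)).
have B0r (U : hermitian_space s) z : base_form t z (0 : tensor i U) = 0.
  exact: (herm0r (V := base_change ti U)).
elim/tensor_ind: u => [|a x u IHu]; first by rewrite tensor_map0 !B0l.
rewrite tensor_mapD !base_formDl IHu; congr (_ + _).
elim/tensor_ind: w {IHu} => [|b y w IHw]; first by rewrite tensor_map0 !B0r.
rewrite tensor_mapD !(base_formDr ti) IHw !tensor_map_pure; congr (_ + _).
by rewrite !(base_formE ti) f_herm.
Qed.

(** * Descent of isometries *)

Section Descent.
Variables (K : unitRingType) (G : orderedZmodType) (v : valuation K G).
Hypothesis K_division : forall a : K, a != 0 -> a \is a GRing.unit.
Variables (s : involution K) (vs : forall a, v (s a) = v a).
Hypothesis v2 : v 2 = Some 0.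
Hypothesis v_sym : forall g : G, exists a : K, v a = Some g /\ a = s a.
Variables V V' : hermitian_space (val_ring_inv vs).
Hypotheses (V_unimodular : unimodular V) (V'_unimodular : unimodular V').

Lemma isometric_descent :
  isometric (base_change (val_ring_invE vs) V)
            (base_change (val_ring_invE vs) V') ->
  isometric V V'.
Proof.
move=> [u0 u0_iso].
have [X [Xorth Xbasis]] := finite_orthogonal_basis K_division V_unimodular v2.
have [u [[u_bij u_herm] uX]] :=
  isometry_into_lattice K_division V'_unimodular v2 v_sym u0_iso Xorth.
pose U : set V := fun x => exists y, u (lattice_vec x) = lattice_vec y.
have Usub : submodule U.
  split=> [|x y [x' ux] [y' uy]|a x [x' ux]].
  - by exists 0; rewrite !lattice_vec0 linear0.
  - by exists (x' + y'); rewrite !lattice_vecD linearD ux uy.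
  - by exists (a *: x'); rewrite !lattice_vecZ linearZ /= ux.
have /choice[f fE] x : U x.
  (* [U] contains the orthogonal basis, hence the projection [z]; and [x - z], orthogonal to the
     basis, is zero. *)
  have [z [zU xz]] := orthogonal_projection K_division x Xorth.
  rewrite (_ : x = z); first exact: zU.
  by apply/eqP; rewrite -subr_eq0; apply/eqP/Xbasis.
have lv_inj := lattice_vec_inj V_unimodular.
have lv_inj' := lattice_vec_inj V'_unimodular.
have fL : linear f.
  move=> a x y; apply: lv_inj'.
  by rewrite -fE !lattice_vecD !lattice_vecZ -!fE linearP.
have f_herm x y : herm (f x) (f y) = herm x y.
  by apply: val_inj; rewrite -!herm_lattice_vec -!fE u_herm.
have f_inj : injective f.
  move=> x y /(congr1 (@lattice_vec _ _ _ _ _ _)); rewrite -!fE.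
  by move=> /(bij_inj u_bij)/lv_inj.
(* Represent the functional pairing [f] with [y] by a vector [x]. Then [y - f x] is orthogonal to
   the image of [f], whose [K]-multiples fill the extension of [V'] as [u] is onto; so it is
   zero. *)
have /choice[g gK] y : exists x, f x = y.
  pose h x : (val_ring v)^o := herm (f x) y.
  have hL : linear h.
    by move=> a x x'; rewrite /h fL (hermDl (hermP V')) hermZl.
  pose h' : {linear V -> (val_ring v)^o} :=
    HB.pack h (GRing.isLinear.Build _ _ _ _ _ hL).
  have [x hx] := unimodular_rep h' V_unimodular.
  exists x; apply/eqP; rewrite eq_sym -subr_eq0; apply/eqP.
  apply: (unimodular_eq0 V'_unimodular) => z; apply: val_inj.
  have [w wK uK] := u_bij; rewrite -herm_lattice_vec -[lattice_vec z]uK.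
  have [a [m ->]] := base_change_pure K_division (w (lattice_vec z)).
  rewrite linearZZ hermZl fE herm_lattice_vec hermBr f_herm -hx subrr.
  by rewrite rmorph0 mulr0.
exists (HB.pack f (GRing.isLinear.Build _ _ _ _ _ fL) : {linear V -> V'}).
by split=> //; exists g => // x; apply: f_inj; rewrite gK.
Qed.

End Descent.

Theorem mainTheorem2 (K : unitRingType)
    (K_division : forall a : K, a != 0 -> a \is a GRing.unit)
    (G : orderedZmodType) (v : valuation K G)
    (v_surj : forall g : G, exists a : K, v a = Some g)
    (s : involution K)
    (v2 : v 2 = Some 0)
    (vs : forall a : K, v (s a) = v a)
    (v_sym : forall g : G, exists a : K, v a = Some g /\ a = s a)
    (V V' : hermitian_space (val_ring_inv vs))
    (V_unimodular : unimodular V) (V'_unimodular : unimodular V') :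
  isometric (base_change (val_ring_invE vs) V)
            (base_change (val_ring_invE vs) V') <->
  isometric V V'.
Proof.
split; last exact: isometric_base_change.
exact: isometric_descent.
Qed.
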